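(* Let $L$ be a rectifiable link in $\mathbb{R}^3$. Then $L$ is strongly critical for length when constrained by link-thickness if and only if there exists a positive Radon measure $\mu$ on $\mathrm{Strut}(L)$ such that, for every smooth vector field $\xi\in \mathrm{VF}^\infty(L)$ along $L$, $$\delta_\xi\mathrm{Len}(L)=\int_{\mathrm{Strut}(L)}A_S\xi\,d\mu .$$
   Context: A curve is a continuous map $M\to\mathbb{R}^3$ from a compact oriented 1-manifold with boundary (finitely many components), up to orientation-preserving reparametrization; points of the curve are points of $M$, identified with their images when convenient. It is closed if every component of $M$ is a circle. A link is a closed curve whose different components have disjoint images (a component may intersect itself). A rectifiable curve has finite length and is parametrized by arclength $s$; $T=dL/ds$ is its unit tangent, defined a.e. The link-thickness $\mathrm{LThi}(L)$ is the minimum distance between points on different components of $L$. A strut is an unordered pair $\{x,y\}$ of points on different components with $|y-x|=\mathrm{LThi}(L)$; $\mathrm{Strut}(L)$ is the compact space of all struts. $\mathrm{VF}(L)$ is the space of continuous $\mathbb{R}^3$-valued vector fields $\xi$ along $L$ (continuous maps $M\to\mathbb{R}^3$), and $\mathrm{VF}^\infty(L)$ the subspace of those that are smooth functions of arclength. The first variation of length is $\delta_\xi\mathrm{Len}(L)=\int_L\langle T,d\xi/ds\rangle\,ds$. The (one-sided) first variation of link-thickness is $\delta^+_\xi\mathrm{LThi}(L)=\frac{d}{dt^+}\big|_{t=0}\mathrm{LThi}(L+t\xi)$. The rigidity operator $A_S\colon \mathrm{VF}(L)\to C(\mathrm{Strut}(L))$ is $(A_S\xi)(\{x,y\})=\langle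 \xi_y-\xi_x,y-x\rangle/|y-x|$, the derivative of $|y-x|$ under the variation $\xi$. $L$ is strongly critical (for minimizing length subject to the constraint that link-thickness is at least $\mathrm{LThi}(L)$) if there is $\varepsilon>0$ such that $\delta^+_\xi\mathrm{LThi}(L)\le-\varepsilon$ for all $\xi\in \mathrm{VF}^\infty(L)$ with $\delta_\xi\mathrm{Len}(L)=-1$. *)

(* Defs.v *)
From HB Require Import structures.
From mathcomp Require Import all_boot all_order all_algebra generic_quotient.
From mathcomp Require Import all_classical all_reals all_analysis.

Set Implicit Arguments.
Unset Strict Implicit.
Unset Printing Implicit Defensive.

Import Order.TTheory GRing.Theory Num.Theory.
Import numFieldNormedType.Exports.

Local Open Scope classical_set_scope.
Local Open Scope ring_scope.

(* The library norm on 'rV[R]_3 is the sup norm; it induces the right topology,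
   but lengths and distances below use the Euclidean norm [enorm]. *)
Section euclidean.
Context {R : realType}.

Definition dot (u v : 'rV[R]_3) : R := \sum_(i < 3) u 0 i * v 0 i.

Definition enorm (v : 'rV[R]_3) : R := Num.sqrt (dot v v).

(* Vector-valued analogue of [variation] and [total_variation]. *)
Definition polygon_length (a b : R) (c : R -> 'rV[R]_3) (s : seq R) : R :=
  let F := c \o nth b (a :: s) in
  \sum_(0 <= k < size s) enorm (F k.+1 - F k).

Definition arc_length (a b : R) (c : R -> 'rV[R]_3) : \bar R :=
  ereal_sup [set (polygon_length a b c s)%:E | s in itv_partition a b].

End euclidean.

Section circle.
Context {R : realType} (l : R).

Definition circle_rel (s t : R) : bool := (s - t) / l \is a Num.int.

Lemma circle_rel_equiv : equiv_class_of circle_rel.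
Proof.
split=> [s|s t|t s u]; rewrite /circle_rel.
- by rewrite subrr mul0r rpred0.
- by rewrite -opprB mulNr rpredN.
- move=> st tu; rewrite -(subrKA t) mulrDl.
  exact: rpredD.
Qed.

Canonical circle_equiv : equiv_rel R := EquivRelPack circle_rel_equiv.

(* The circle R/lZ of circumference l. *)
Definition circle : Type := quotient_topology {eq_quot circle_equiv}%qT.

HB.instance Definition _ := Topological.on circle.

Definition to_circle (s : R) : circle := (\pi_circle s)%qT.

End circle.

Section curve.
Context {R : realType} {n : nat} (len : 'I_n -> R).

Definition circles : Type := {i : 'I_n & circle (len i)}.

HB.instance Definition _ := Topological.on circles.

(* The point with arclength coordinate s (modulo len i) on the i-th circle. *)
Definition pt (i : 'I_n) (s : R) : circles :=
  existT (fun i => circle (len i)) i (to_circle (len i) s).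

Definition component (x : circles) : 'I_n := tag x.

Definition along (f : circles -> 'rV[R]_3) (i : 'I_n) : R -> 'rV[R]_3 :=
  fun s => f (pt i s).

Definition LThi (f : circles -> 'rV[R]_3) : R :=
  inf [set d | exists x y : circles,
         component x != component y /\ d = enorm (f y - f x)].

Definition VF (xi : circles -> 'rV[R]_3) : Prop := continuous xi.

Definition VF_smooth (xi : circles -> 'rV[R]_3) : Prop :=
  VF xi /\ forall i k s, derivable (derive1n k (along xi i)) s 1.

End curve.

(* Curves are considered up to reparametrization, and a rectifiable curve is
   represented by its arclength parametrization. At least two components are
   required: otherwise the minimum defining the link-thickness is over the
   empty set. *)
Record rectifiable_link (R : realType) := RectifiableLink {
  ncomp : nat;
  len : 'I_ncomp -> R;
  curve :> circles len -> 'rV[R]_3;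
  ncomp_gt1 : (1 < ncomp)%N;
  len_gt0 : forall i, 0 < len i;
  curve_continuous : continuous curve;
  curve_arclength : forall i a b, a <= b ->
    arc_length a b (along curve i) = (b - a)%:E;
  curve_disjoint : forall x y,
    component x != component y -> curve x != curve y }.

Arguments len {R} _ _.

Section variation.
Context {R : realType} (L : rectifiable_link R).
Implicit Type xi : circles (len L) -> 'rV[R]_3.

(* T; meaningful only almost everywhere. *)
Definition tangent (i : 'I_(ncomp L)) : R -> 'rV[R]_3 := derive1 (along L i).

Definition dLen xi : R :=
  \sum_(i < ncomp L)
    \int[lebesgue_measure]_(s in `[0, len L i]) dot (tangent i s) (derive1 (along xi i) s).

Definition dLThi xi : R :=
  lim ((fun t : R => (LThi (fun x => L x + t *: xi x) - LThi L) / t) @ 0^'+).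

Definition strongly_critical : Prop :=
  exists2 e : R, 0 < e &
    forall xi, VF_smooth xi -> dLen xi = -1 -> dLThi xi <= - e.

(* An unordered pair of points on different components is encoded by its unique
   ordering with increasing component index. *)
Definition struts : set (circles (len L) * circles (len L)) :=
  [set p | (component p.1 < component p.2)%N /\ enorm (L p.2 - L p.1) = LThi L].

Lemma circle_compact (l : R) : 0 < l -> compact [set: circle l].
Proof.
move=> l0.
have -> : [set: circle l] = to_circle l @` `[0, l].
  apply/esym/seteqP; split=> // q _ /=.
  set r : R := repr q; set k := Num.floor (r / l).
  exists (r - k%:~R * l).
    rewrite /= in_itv /= subr_ge0 -ler_pdivlMr// floor_le/=.
    rewrite lerBlDl -[X in _ + X]mul1r -mulrDl -ler_pdivrMr//.
    by rewrite ltW// -intrD1 floorD1_gt.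
  rewrite /to_circle -[RHS]reprK; apply/eqmodP; rewrite /= /circle_rel.
  by rewrite addrAC subrr add0r mulNr mulfK ?gt_eqF// rpredN intr_int.
apply: continuous_compact; last exact: segment_compact.
by apply: continuous_subspaceT; exact: pi_continuous.
Qed.

Lemma enorm_continuous : continuous (@enorm R).
Proof.
have dot_continuous : continuous (fun v : 'rV[R]_3 => dot v v).
  apply: continuous_big => [|i _ v]; first exact: add_continuous.
  apply: (@continuousM _ _ (fun w : 'rV[R]_3 => w 0 i) (fun w => w 0 i));
    exact: coord_continuous.
move=> v; apply: continuous_comp; first exact: dot_continuous.
exact: sqrt_continuous.
Qed.

Lemma struts_nonempty : struts !=set0.
Proof.
pose d (p : circles (len L) * circles (len L)) := enorm (L p.2 - L p.1).
pose A : set (circles (len L) * circles (len L)) :=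
  [set p | component p.1 != component p.2].
have cptA : compact A.
  pose C i : set (circles (len L)) := existT _ i @` [set: circle (len L i)].
  have cptC i : compact (C i).
    apply: continuous_compact; last exact: circle_compact (len_gt0 i).
    apply: continuous_subspaceT.
    exact: (@existT_continuous _ (fun i => circle (len L i) : topologicalType)).
  have -> : A = \big[setU/set0]_(ij : 'I_(ncomp L) * 'I_(ncomp L) |
                    ij.1 != ij.2) (C ij.1 `*` C ij.2).
    rewrite -(bigcup_pred [pred ij | ij.1 != ij.2]); apply/seteqP.
    split=> [[[i x] [j y]]|[x y]] /=.
      by exists (i, j); [|split; [exists x|exists y]].
    by move=> [[i j] ij /= [[? _ <-] [? _ <-]]].
  by apply: bigsetU_compact => ij _; exact: compact_setX.
have cd : {within A, continuous d}.
  apply: continuous_subspaceT => p; apply: continuous_comp; last first.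
    exact: enorm_continuous.
  apply: cvgB; apply: continuous_comp (@curve_continuous R L _).
    exact: cvg_snd.
  exact: cvg_fst.
have [|p /set_mem Ap dmin] := compact_EVT_min _ cptA cd.
  pose i0 := Ordinal (ltnW (ncomp_gt1 L)); pose i1 := Ordinal (ncomp_gt1 L).
  by exists (pt (len L) i0 0, pt (len L) i1 0).
have dp : d p = LThi L.
  apply/eqP; rewrite eq_le; apply/andP; split.
    apply: lb_le_inf; first by exists (d p), p.1, p.2.
    by move=> _ [x [y [xy ->]]]; apply: (dmin (x, y)); exact/mem_set.
  apply: inf_lbound; last by exists p.1, p.2.
  by exists 0 => _ [x [y [_ ->]]]; exact: sqrtr_ge0.
have [lt12|lt21|e12] := ltngtP (component p.1) (component p.2).
- by exists p.
- exists (p.2, p.1); split=> //=.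
  rewrite -dp /d /enorm /dot; congr Num.sqrt; apply: eq_bigr => i _.
  by rewrite !mxE -mulrNN !opprB.
- by move: Ap; rewrite /A /= (val_inj e12) eqxx.
Qed.

Definition Strut : Type := set_type struts.

HB.instance Definition _ := Topological.on Strut.

(* A [measurableType] has to be pointed. *)
Definition strut_point : Strut :=
  let (p, pS) := cid struts_nonempty in exist _ p (mem_set pS).

HB.instance Definition _ := isPointed.Build Strut strut_point.

Definition rigidity xi (p : Strut) : R :=
  let x := (\val p).1 in let y := (\val p).2 in
  dot (xi y - xi x) (L y - L x) / enorm (L y - L x).

End variation.

Notation borel T := (g_sigma_algebraType (@open T)).

(* For compact T, finiteness on compact sets is local finiteness. *)
Definition radon (R : realType) (T : ptopologicalType)
    (mu : {measure set (borel T) -> \bar R}) : Prop :=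
  (forall K : set T, compact K -> (mu K < +oo)%E) /\
  (forall A : set (borel T), measurable A ->
     mu A = ereal_sup [set mu K | K in [set K : set T | compact K /\ K `<=` A]]).

(* Main.v *)
From HB Require Import structures.
Require Import Defs.
From mathcomp Require Import all_boot all_order all_algebra.
From mathcomp Require Import all_classical all_reals all_analysis.
From mathcomp Require Import measurable_realfun.
From mathcomp Require Import ring lra.

Set Implicit Arguments.
Unset Strict Implicit.
Unset Printing Implicit Defensive.

Import Order.TTheory GRing.Theory Num.Theory.
Import numFieldNormedType.Exports.

Local Open Scope classical_set_scope.
Local Open Scope ring_scope.

(** Write [A xi] for the rigidity of a vector field [xi], a continuous function
on the compact Hausdorff space of struts. The equivalence is a duality between
two statements about the pairs [(A xi, dLen xi)].

The link-thickness is the minimum of the chord lengths [|L y - L x|] over the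
compact set of pairs of points on different components. As for any minimum of a
compact family, its one-sided derivative is the minimum of the derivatives over
the pairs where the minimum is attained, so [dLThi xi] is the minimum of [A xi]
over the struts ([dLThi_min]). Strong criticality with constant [e] thus says
that [dLen xi = -1] forces [min A xi <= - e].

If [dLen xi] is the integral of [A xi] against a Radon measure [mu], then [mu]
is finite because the space of struts is compact, and [dLen xi = -1] gives
[min A xi * mu(Strut) <= -1], which is strong criticality
([measure_strongly_critical]).

Conversely, applying strong criticality to negative multiples of [xi] turns it
into the inequality [dLen xi <= e^-1 * sup (max (A xi) 0)] for all smooth [xi]
([strongly_critical_bound]). The right-hand side is a sublinear functional of
[A xi], so the pairs [(A xi, dLen xi)] form the graph of a linear functional on
a space of continuous functions, which extends to all continuous functions
under the same bound ([hahn_banach]). The bound vanishes on nonpositive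
functions, hence the extension is positive and is the integral against a Radon
measure ([riesz_markov]).

That these pairs form a linear space needs [dLen] to be linear, that is, the
integrals defining it to converge: the tangent is a Borel function, being the
derivative of a continuous function, and it is bounded since the curve has unit
speed ([dLen_integrable]). *)

(** * Hahn-Banach extension under a sublinear bound *)

Section hahn_banach.
Context {R : realType} {V : lmodType R}.
Variables (D : set V) (p : V -> R).

(** Partial linear functionals are handled through their graphs: extension is
then plain inclusion, and a union of a chain of graphs is again a graph. *)
Definition linear_graph (G : set (V * R)) :=
  forall a x y, G x -> G y -> G (a *: x.1 + y.1, a * x.2 + y.2).

(** Domination by a sublinear [p] makes a linear graph single-valued, since
[(0, r)] in the graph forces [r <= p 0 = 0] for both [r] and [- r]. *)
Definition dominated_graph (G : set (V * R)) :=
  linear_graph G /\ forall x, G x -> D x.1 /\ x.2 <= p x.1.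

Hypothesis D_lincomb : forall a u v, D u -> D v -> D (a *: u + v).
Hypothesis p_subadd : forall u v, D u -> D v -> p (u + v) <= p u + p v.
Hypothesis p_homo : forall a u, 0 < a -> D u -> p (a *: u) = a * p u.

(** Zorn's lemma is applied to the sets [A] such that [A `|` G] is dominated
rather than to the dominated graphs containing [G], so that the empty chain has
an upper bound too. *)
Lemma maximal_dominated (G : set (V * R)) : dominated_graph G ->
  exists2 M, dominated_graph M /\ G `<=` M &
    forall N, dominated_graph N -> M `<=` N -> N `<=` M.
Proof.
move=> domG.
have [F Ftot Fdom|A [domA maxA]] := @Zorn_bigcup _ (fun A => dominated_graph (A `|` G)).
  split=> [a x y [[X FX Xx]|Gx] [[Y FY Yy]|Gy]|x [[X FX Xx]|/domG.2//]].
  - have [XY|YX] := Fdom _ _ FX FY.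
    + have [/(_ a x y) []] := Ftot _ FY; try by [left; exact: XY|left].
        by move=> h; left; exists Y.
      by right.
    + have [/(_ a x y) []] := Ftot _ FX; try by [left; exact: YX|left].
        by move=> h; left; exists X.
      by right.
  - have [/(_ a x y) []] := Ftot _ FX; [by left|by right| |by right].
    by move=> h; left; exists X.
  - have [/(_ a x y) []] := Ftot _ FY; [by right|by left| |by right].
    by move=> h; left; exists Y.
  - by right; exact: domG.1.
  - by apply: (Ftot _ FX).2; left.
exists (A `|` G); first by split=> // x Gx; right.
move=> N domN AGN; apply: contrapT => NAG.
apply: (maxA N).
  split; first by move=> x Ax; apply: AGN; left.
  by move=> NA; apply: NAG => x /NA; left.
by rewrite setUidl// => x Gx; apply: AGN; right.
Qed.

(** A linear extension to [v0] must take there a value [r0] between the two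
families of bounds; each lower bound is below each upper bound by subadditivity
of [p] at [(x.1 - v0) + (y.1 + v0)]. *)
Lemma extension_value (M : set (V * R)) v0 : dominated_graph M -> M !=set0 -> D v0 ->
  exists r0, forall x, M x -> x.2 - p (x.1 - v0) <= r0 <= p (x.1 + v0) - x.2.
Proof.
move=> [lM dM] [m Mm] Dv0.
have Dm x : M x -> D (x.1 - v0).
  by move=> /dM[Dx _]; rewrite addrC -scaleN1r; exact: D_lincomb.
have Dp x : M x -> D (x.1 + v0).
  by move=> /dM[Dx _]; rewrite -[x.1]scale1r; exact: D_lincomb.
have key x y : M x -> M y -> x.2 - p (x.1 - v0) <= p (y.1 + v0) - y.2.
  move=> Mx My; have /dM[_ /=] := lM 1 x y Mx My.
  rewrite scale1r mul1r => h.
  have := p_subadd (Dm _ Mx) (Dp _ My).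
  rewrite addrACA [- v0 + _]addrC subrr addr0 => h2.
  by rewrite lerBlDr addrAC lerBrDr (le_trans h)// addrC.
exists (sup [set x.2 - p (x.1 - v0) | x in M]) => x Mx; apply/andP; split.
  apply: ub_le_sup; last by exists x.
  by exists (p (x.1 + v0) - x.2) => _ [y My <-]; exact: key.
apply: ge_sup; first by exists (m.2 - p (m.1 - v0)), m.
by move=> _ [y My <-]; exact: key.
Qed.

(** The graph spanned by [M] and [(v0, r0)] is still dominated: scaling by the
inverse of the coefficient of [v0] reduces the bound to [extension_value], its
upper half when the coefficient is positive and its lower half when negative. *)
Lemma maximal_total (M : set (V * R)) : dominated_graph M -> M !=set0 ->
  (forall N, dominated_graph N -> M `<=` N -> N `<=` M) ->
  forall v, D v -> exists r, M (v, r).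
Proof.
move=> domM M0 maxM v0 Dv0.
have [r0 hr0] := extension_value domM M0 Dv0.
have [lM dM] := domM; case: (M0) => m Mm.
have M00 : M (0, 0).
  have := lM (- 1) m m Mm Mm.
  by rewrite scaleN1r mulN1r !addNr.
have Msc a x : M x -> M (a *: x.1, a * x.2).
  by move=> Mx; have := lM a x _ Mx M00; rewrite /= !addr0.
pose N : set (V * R) := [set y | exists a x, M x /\ y = (x.1 + a *: v0, x.2 + a * r0)].
have MN : M `<=` N.
  by move=> x Mx; exists 0, x; rewrite scale0r mul0r !addr0 -surjective_pairing.
exists r0; apply: (maxM N) => //; last first.
  by exists 1, (0, 0); split=> //=; rewrite !add0r scale1r mul1r.
split=> [a _ _ [b [x [Mx ->]]] [c [y [My ->]]] /=|_ [a [x [Mx ->]]] /=].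
  exists (a * b + c), (a *: x.1 + y.1, a * x.2 + y.2); split; first exact: lM.
  congr (_, _) => /=; last by ring.
  by rewrite scalerDr scalerDl scalerA addrACA.
have [Dx px] := dM _ Mx.
split; first by rewrite addrC; exact: D_lincomb.
have [a0|a0|->] := ltgtP a 0; last by rewrite scale0r mul0r !addr0.
- have b0 : 0 < - a by rewrite oppr_gt0.
  have /hr0 /andP[/= + _] := Msc (- a)^-1 x Mx.
  have -> : x.1 + a *: v0 = (- a) *: ((- a)^-1 *: x.1 - v0).
    by rewrite scalerBr scalerA mulfV ?gt_eqF// scale1r scaleNr opprK.
  have Dv : D ((- a)^-1 *: x.1 - v0).
    rewrite -scaleN1r addrC; apply: D_lincomb => //.
    by have /dM[] := Msc (- a)^-1 x Mx.
  rewrite p_homo// lerBlDr -(ler_pM2l b0) mulrDr mulrA mulfV ?gt_eqF// mul1r.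
  lra.
- have /hr0 /andP[_ /=] := Msc a^-1 x Mx.
  have -> : x.1 + a *: v0 = a *: (a^-1 *: x.1 + v0).
    by rewrite scalerDr scalerA mulfV ?gt_eqF// scale1r.
  have Dv : D (a^-1 *: x.1 + v0) by exact: D_lincomb.
  rewrite p_homo// lerBrDr -(ler_pM2l a0) mulrDr mulrA mulfV ?gt_eqF// mul1r.
  lra.
Qed.

Theorem hahn_banach (G : set (V * R)) : dominated_graph G -> G !=set0 ->
  exists f : V -> R,
    [/\ forall a u v, D u -> D v -> f (a *: u + v) = a * f u + f v,
        forall u, D u -> f u <= p u &
        forall x, G x -> f x.1 = x.2].
Proof.
move=> domG G0.
have [M [domM GM] maxM] := maximal_dominated domG.
have M0 : M !=set0 by case: G0 => g /GM; exists g.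
have totM := maximal_total domM M0 maxM.
have /choice[f fP] : forall v, exists r, D v -> M (v, r).
  move=> v; have [Dv|nDv] := pselect (D v); last by exists 0.
  by have [r Mr] := totM v Dv; exists r.
have [lM dM] := domM.
have uniq_le v r s : M (v, r) -> M (v, s) -> r <= s.
  move=> Mr Ms.
  have Mrs : M (0, r - s).
    by have := lM (- 1) _ _ Ms Mr; rewrite /= scaleN1r addNr mulN1r addrC.
  have /dM[/= D0] := Mrs.
  have := p_homo (ltr0n _ 2) D0; rewrite scaler0; lra.
have uniq v r s : M (v, r) -> M (v, s) -> r = s.
  by move=> Mr Ms; apply/eqP; rewrite eq_le !(uniq_le v).
exists f; split=> [a u v Du Dv|u Du|[u r] Gx].
- apply: uniq (fP _ (D_lincomb a Du Dv)) _.
  exact: (lM a _ _ (fP _ Du) (fP _ Dv)).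
- by have /dM[] := fP _ Du.
- have Mx := GM _ Gx; have [Du _] := dM _ Mx.
  exact: uniq (fP _ Du) Mx.
Qed.

End hahn_banach.

(** * Continuous functions on a compact Borel space *)

Section borel_continuous.
Context {R : realType} {X : ptopologicalType}.
Implicit Types f : X -> R.

Lemma continuous_lin a f g : continuous f -> continuous g ->
  continuous (fun x => a * f x + g x).
Proof.
by move=> cf cg x; apply: cvgD; [apply: cvgM; [exact: cvg_cst|exact: cf]|exact: cg].
Qed.

Lemma open_measurable_borel (U : set X) : open U -> measurable (U : set (borel X)).
Proof. by move=> oU; exact: sub_sigma_algebra. Qed.

Lemma closed_measurable_borel (F : set X) : closed F -> measurable (F : set (borel X)).
Proof.
move=> cF; rewrite -[F]setCK; apply: measurableC.
by apply: open_measurable_borel; exact: closed_openC.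
Qed.

Lemma continuous_measurable_borel f : continuous f ->
  measurable_fun [set: borel X] (f : borel X -> R).
Proof.
move=> cf; apply: (measurability _ (RGenOInfty.measurableE R)).
move=> _ [_ [a ->] <-]; rewrite setTI; apply: open_measurable_borel.
by move/continuousP: cf; apply; exact: interval_open.
Qed.

Hypothesis cptX : compact [set: X].

Lemma continuous_compact_bounded f : continuous f ->
  exists2 M, 0 < M & forall x, `|f x| <= M.
Proof.
move=> cf; have : compact (f @` setT).
  by apply: continuous_compact => //; exact: continuous_subspaceT.
move=> /compact_bounded /pinfty_ex_gt0[M M0 hM].
by exists M => // x; apply: hM; exists x.
Qed.

Lemma continuous_integrable (mu : {measure set (borel X) -> \bar R}) f :
  (mu setT < +oo)%E -> continuous f -> mu.-integrable setT (EFin \o f).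
Proof.
move=> mu_fin cf; have [M M0 fM] := continuous_compact_bounded cf.
apply: measurable_bounded_integrable => //; first exact: continuous_measurable_borel.
by exists M; split; rewrite ?num_real// => x Mx y _ /=; exact: le_trans (fM _) (ltW Mx).
Qed.

End borel_continuous.

(** * Riesz-Markov representation on compact Hausdorff spaces *)

Section riesz_markov.
Context {R : realType} {X : ptopologicalType}.
Hypothesis cptX : compact [set: X].
Hypothesis hausX : hausdorff_space X.
Variable Lam : (X -> R) -> R.
Hypothesis Lam_lin : forall a (f g : X -> R), continuous f -> continuous g ->
  Lam (fun x => a * f x + g x) = a * Lam f + Lam g.
Hypothesis Lam_ge0 : forall f : X -> R,
  continuous f -> (forall x, 0 <= f x) -> 0 <= Lam f.

Let cst_cont (c : R) : continuous (fun _ : X => c).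
Proof. by move=> x; exact: cvg_cst. Qed.

Lemma functional0 : Lam (fun=> 0) = 0.
Proof.
suff : Lam (fun=> 0) = 1 * Lam (fun=> 0) + Lam (fun=> 0) by lra.
by rewrite -Lam_lin//; congr Lam; apply/funext => x; rewrite mulr0 addr0.
Qed.

Implicit Types f g : X -> R.

Lemma functionalD f g : continuous f -> continuous g ->
  Lam (fun x => f x + g x) = Lam f + Lam g.
Proof.
move=> cf cg; rewrite -[Lam f]mul1r -Lam_lin//; congr Lam.
by apply/funext => x; rewrite mul1r.
Qed.

Lemma functionalZ a f : continuous f -> Lam (fun x => a * f x) = a * Lam f.
Proof.
move=> cf; rewrite -[RHS]addr0 -functional0 -Lam_lin//; congr Lam.
by apply/funext => x; rewrite addr0.
Qed.

Lemma functionalB f g : continuous f -> continuous g ->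
  Lam (fun x => f x - g x) = Lam f - Lam g.
Proof.
move=> cf cg; rewrite -mulN1r addrC -Lam_lin//; congr Lam.
by apply/funext => x; rewrite mulN1r addrC.
Qed.

Lemma le_functional f g : continuous f -> continuous g ->
  (forall x, f x <= g x) -> Lam f <= Lam g.
Proof.
move=> cf cg fg; rewrite -subr_ge0 -functionalB//; apply: Lam_ge0.
  by move=> x; apply: cvgB; [exact: cg|exact: cf].
by move=> x; rewrite subr_ge0.
Qed.

(** Admissible functions for the value of the functional on a set: continuous
majorants of its indicator. *)
Definition majorants (K : set X) : set (X -> R) :=
  [set f : X -> R | [/\ continuous f, forall x, 0 <= f x & forall x, K x -> 1 <= f x]].

Definition content (K : set X) : R := inf [set Lam f | f in majorants K].

Let majorants_lbound K : has_lbound [set Lam f | f in majorants K].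
Proof. by exists 0 => _ [f [cf f0 _] <-]; exact: Lam_ge0. Qed.

Let majorants1 K : majorants K (fun=> 1).
Proof. by split. Qed.

Let majorants_n0 K : [set Lam f | f in majorants K] !=set0.
Proof. by exists (Lam (fun=> 1)); exists (fun=> 1). Qed.

Lemma content_le K f : majorants K f -> content K <= Lam f.
Proof. by move=> Kf; apply: ge_inf => //; exists f. Qed.

Lemma content_ge K a : (forall f, majorants K f -> a <= Lam f) -> a <= content K.
Proof.
move=> Ka; apply: lb_le_inf => //; by move=> _ [f /Ka + <-].
Qed.

Lemma content_ge0 K : 0 <= content K.
Proof. by apply: content_ge => f [cf f0 _]; exact: Lam_ge0. Qed.

Lemma content0 : content set0 = 0.
Proof.
by apply/eqP; rewrite eq_le content_ge0 andbT -functional0; exact: content_le.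
Qed.

Lemma contentT : content setT = Lam (fun=> 1).
Proof.
apply/eqP; rewrite eq_le content_le//=; apply: content_ge => f [cf f0 f1].
by apply: le_functional => // x; exact: f1.
Qed.

Lemma le_content K1 K2 : K1 `<=` K2 -> content K1 <= content K2.
Proof.
move=> K12; apply: content_ge => f [cf f0 f1]; apply: content_le; split=> // x /K12.
exact: f1.
Qed.

Lemma contentU K1 K2 : content (K1 `|` K2) <= content K1 + content K2.
Proof.
rewrite -lerBlDr; apply: content_ge => f [cf f0 f1].
rewrite lerBlDr addrC -lerBlDr; apply: content_ge => g [cg g0 g1].
rewrite lerBlDr -functionalD//; apply: content_le; split.
- by move=> x; apply: cvgD; [exact: cg|exact: cf].
- by move=> x; rewrite addr_ge0.
- by move=> x [/f1|/g1] h; rewrite (le_trans h)// ?lerDl ?lerDr.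
Qed.

Lemma separating_function (A B : set X) : closed A -> closed B -> A `&` B = set0 ->
  exists g : X -> R, [/\ continuous g, forall x, 0 <= g x <= 1,
    forall x, A x -> g x = 1 & forall x, B x -> g x = 0].
Proof.
move=> cA cB AB.
have /(@normal_separatorP R)/(_ B A cB cA) := compact_normal hausX cptX.
rewrite setIC => /(_ AB)/(@uniform_separatorP _ R)[g [cg g01 gB gA]].
exists g; split=> // x.
- have /g01 : range g (g x) by exists x.
  by rewrite /= in_itv.
- by move=> Ax; apply: gA; exists x.
- by move=> Bx; apply: gB; exists x.
Qed.

(** A majorant of [A `|` B] splits as [f * g + (f - f * g)] with [g] equal to 1 on
[A] and to 0 on [B]; the two terms are majorants of [A] and of [B]. *)
Lemma content_disjoint A B : closed A -> closed B -> A `&` B = set0 ->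
  content A + content B <= content (A `|` B).
Proof.
move=> cA cB AB; have [g [cg g01 gA gB]] := separating_function cA cB AB.
apply: content_ge => f [cf f0 f1].
have cfg : continuous (fun x => f x * g x).
  by move=> x; apply: cvgM; [exact: cf|exact: cg].
have cfg' : continuous (fun x => f x - f x * g x).
  by move=> x; apply: cvgB; [exact: cf|exact: cfg].
have -> : Lam f = Lam (fun x => f x * g x) + Lam (fun x => f x - f x * g x).
  by rewrite -functionalD//; congr Lam; apply/funext => x; rewrite subrKC.
apply: lerD; apply: content_le; split=> // x.
- by rewrite mulr_ge0//; case/andP: (g01 x).
- by move=> Ax; rewrite gA// mulr1 f1//; left.
- by rewrite subr_ge0 ler_piMr//; case/andP: (g01 x).
- by move=> Bx; rewrite gB// mulr0 subr0 f1//; right.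
Qed.

Local Open Scope ereal_scope.

Definition open_content (U : set X) : \bar R :=
  ereal_sup [set (content K)%:E | K in [set K | closed K /\ K `<=` U]].

Definition outer_content (A : set X) : \bar R :=
  ereal_inf [set open_content U | U in [set U | open U /\ A `<=` U]].

Lemma le_open_content U V : U `<=` V -> open_content U <= open_content V.
Proof.
move=> UV; apply: ge_ereal_sup => _ [K [cK KU] <-]; apply: ereal_sup_ubound.
by exists K => //; split=> //; exact: subset_trans UV.
Qed.

Lemma content_le_open K U : closed K -> K `<=` U -> (content K)%:E <= open_content U.
Proof. by move=> cK KU; apply: ereal_sup_ubound; exists K. Qed.

Lemma open_content_ge0 U : 0 <= open_content U.
Proof.
have <- : (content set0)%:E = 0 by rewrite content0.
by apply: content_le_open => //; exact: closed0.
Qed.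

Lemma open_content0 : open_content set0 = 0.
Proof.
apply/eqP; rewrite eq_le open_content_ge0 andbT.
by apply: ge_ereal_sup => _ [K [_ K0] <-]; rewrite (_ : K = set0) ?content0// -subset0.
Qed.

Lemma open_content_le U : open_content U <= (Lam (fun=> 1%R))%:E.
Proof.
apply: ge_ereal_sup => _ [K [cK KU] <-]; rewrite lee_fin -contentT.
exact: le_content.
Qed.

(** A closed subset of [U `|` V] is the union of a closed subset of [U] and one of
[V], cut out along the level 1/2 of a function separating its parts outside [V]
and outside [U]. *)
Lemma open_contentU U V : open U -> open V ->
  open_content (U `|` V) <= open_content U + open_content V.
Proof.
move=> oU oV; apply: ge_ereal_sup => _ [K [cK KUV] <-].
have cKV : closed (K `\` V) by apply: closedI => //; exact: open_closedC.
have cKU : closed (K `\` U) by apply: closedI => //; exact: open_closedC.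
have [|g [cg g01 gV gU]] := separating_function cKV cKU.
  by rewrite -subset0 => x [[Kx nVx] [_ nUx]]; have [] := KUV x Kx.
pose K1 := K `&` [set x | (2^-1 <= g x)%R]; pose K2 := K `&` [set x | (g x <= 2^-1)%R].
have cK1 : closed K1.
  apply: closedI => //; have /continuous_closedP cgP := cg.
  exact: (cgP _ (@closed_ge R 2^-1)).
have cK2 : closed K2.
  apply: closedI => //; have /continuous_closedP cgP := cg.
  exact: (cgP _ (@closed_le R 2^-1)).
have -> : K = K1 `|` K2.
  rewrite -setIUr setIidl// => x _ /=.
  by have [/ltW|] := ltP (g x) 2^-1%R; [right|left].
apply: (@le_trans _ _ (content K1 + content K2)%:E); first by rewrite lee_fin contentU.
rewrite EFinD; apply: leeD; apply: content_le_open => // x [Kx /= gx].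
- apply: contrapT => nUx; move: gx; rewrite gU//.
  by rewrite leNgt invr_gt0 ltr0n.
- apply: contrapT => nVx; move: gx; rewrite gV//.
  by rewrite leNgt invf_lt1// ltr1n.
Qed.

Lemma open_content_bigsetU (U : (set X)^nat) n : (forall i, open (U i)) ->
  open_content (\big[setU/set0]_(i < n) U i) <= \sum_(i < n) open_content (U i).
Proof.
move=> oU; elim: n => [|n ih].
  by rewrite !big_ord0 open_content0.
rewrite !big_ord_recr/= (le_trans (open_contentU _ _))//.
  by apply: big_ind => [|A B|i _]; [exact: open0|exact: openU|exact: oU].
by rewrite leeD2r.
Qed.

(** Only closed subsets of the union matter, and by compactness these are covered
by finitely many of the open sets. *)
Lemma open_content_bigcup (U : (set X)^nat) : (forall i, open (U i)) ->
  open_content (\bigcup_i U i) <= \sum_(i <oo) open_content (U i).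
Proof.
move=> oU; apply: ge_ereal_sup => _ [K [cK KU] <-].
have cptK : compact K by exact: subclosed_compact cptX _.
have := cptK; rewrite compact_cover => /(_ nat setT U (fun i _ => oU i) KU)[D _ KD].
pose N := (\max_(i <- finmap.enum_fset D) i).+1.
have KN : K `<=` \big[setU/set0]_(i < N) U i.
  move=> x /KD[i /= iD Uix]; rewrite -bigcup_mkord; exists i => //=.
  by rewrite ltnS; exact: leq_bigmax_seq.
rewrite (le_trans (content_le_open cK KN))// (le_trans (open_content_bigsetU _ _))//.
rewrite -(big_mkord xpredT (fun i => open_content (U i))).
by apply: nneseries_lim_ge => *; exact: open_content_ge0.
Qed.

Lemma outer_content_open U : open U -> outer_content U = open_content U.
Proof.
move=> oU; apply/eqP; rewrite eq_le; apply/andP; split.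
  by apply: ereal_inf_lbound; exists U => //; split.
by apply: le_ereal_inf_tmp => _ [V [oV UV] <-]; exact: le_open_content.
Qed.

Lemma outer_content_le A U : open U -> A `<=` U -> outer_content A <= open_content U.
Proof. by move=> oU AU; apply: ereal_inf_lbound; exists U. Qed.

Lemma outer_content_ge0 A : 0 <= outer_content A.
Proof. by apply: le_ereal_inf_tmp => _ [V _ <-]; exact: open_content_ge0. Qed.

Lemma outer_content0 : outer_content set0 = 0.
Proof.
apply/eqP; rewrite eq_le outer_content_ge0 andbT outer_content_open ?open_content0//.
exact: open0.
Qed.

Lemma le_outer_content : {homo outer_content : A B / A `<=` B >-> A <= B}.
Proof.
move=> A B AB; apply: le_ereal_inf_tmp => _ [V [oV BV] <-].
by apply: outer_content_le => //; exact: subset_trans BV.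
Qed.

Lemma outer_content_fin A : outer_content A \is a fin_num.
Proof.
rewrite ge0_fin_numE ?outer_content_ge0// (@le_lt_trans _ _ (open_content setT))//.
  by apply: outer_content_le => //; exact: openT.
by rewrite (le_lt_trans (open_content_le _))// ltry.
Qed.

Lemma outer_content_approx A (e : R) : (0 < e)%R ->
  exists U, [/\ open U, A `<=` U & open_content U <= outer_content A + e%:E].
Proof.
move=> e0; have [_ [U [oU AU] <-] h] := lb_ereal_inf_adherent e0 (outer_content_fin A).
by exists U; split=> //; exact: ltW.
Qed.

Lemma outer_content_sigma_subadditive : sigma_subadditive outer_content.
Proof.
move=> A; apply/lee_addgt0Pr => e e0.
have /choice[U UP] : forall n, exists U, [/\ open U, A n `<=` U &
    open_content U <= outer_content (A n) + (e / (2 ^ n.+1)%:R)%:E].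
  by move=> n; apply: outer_content_approx; rewrite divr_gt0// ltr0n expn_gt0.
apply: (@le_trans _ _ (\sum_(n <oo) (outer_content (A n) + (e / (2 ^ n.+1)%:R)%:E))).
  apply: (@le_trans _ _ (\sum_(n <oo) open_content (U n))); last first.
    apply: lee_nneseries => [i _ _|i _]; first exact: open_content_ge0.
    by have [] := UP i.
  apply: le_trans (open_content_bigcup _); last by move=> i; have [] := UP i.
  apply: outer_content_le; first by apply: bigcup_open => i _; have [] := UP i.
  by apply: subset_bigcup => i _; have [] := UP i.
by apply: epsilon_trick => [n|]; [exact: outer_content_ge0|exact: ltW].
Qed.

(** Packed by hand: the axioms hold only under the hypotheses on [X] and [Lam], so
this is not a canonical instance. *)
Definition outer_content_measure : {outer_measure set X -> \bar R} :=
  HB.pack outer_content (isOuterMeasure.Build R X outer_content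
    outer_content0 outer_content_ge0 le_outer_content outer_content_sigma_subadditive).

(** For [A] inside an open [V], closed subsets [K] of [V `&` U] and [H] of
[V `\` K] are disjoint, so their contents add up to at most that of [V]; taking
the supremum over [H], then over [K], gives the Caratheodory inequality. *)
Lemma open_caratheodory U : open U -> outer_content.-caratheodory U.
Proof.
move=> oU; apply: (@le_caratheodory_measurable R X outer_content_measure) => A.
apply: le_ereal_inf_tmp => _ [V [oV AV] <-].
apply: (@le_trans _ _ (open_content (V `&` U) + outer_content (A `&` ~` U))).
  by rewrite leeD2r// outer_content_le//; [exact: openI|exact: setSI].
rewrite -leeBrDr ?outer_content_fin//; apply: ge_ereal_sup => _ [K [cK KVU] <-].
rewrite leeBrDr ?outer_content_fin//.
apply: (@le_trans _ _ ((content K)%:E + open_content (V `\` K))).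
  rewrite leeD2l// outer_content_le//; first by apply: openI => //; exact: closed_openC.
  by move=> x [/AV Vx nUx]; split=> // /KVU[].
rewrite addeC -leeBrDr//; apply: ge_ereal_sup => _ [H [cH HVK] <-].
rewrite leeBrDr// -EFinD addrC.
apply: (@le_trans _ _ (content (K `|` H))%:E).
  rewrite lee_fin content_disjoint//.
  by rewrite -subset0 => x [Kx /HVK[]].
apply: content_le_open; first exact: closedU.
by move=> x [/KVU[]|/HVK[]].
Qed.

Let om := outer_content_measure.

Lemma borel_caratheodory : <<s @open X >> `<=` om.-cara.-measurable.
Proof.
apply: smallest_sub; last by move=> U; exact: open_caratheodory.
split=> [|A mA|F mF].
- exact: measurable0.
- by rewrite setTD; exact: measurableC.
- exact: bigcupT_measurable.
Qed.

Lemma outer_content_sigma_additive :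
  semi_sigma_additive (outer_content : set (borel X) -> \bar R).
Proof.
move=> A mA tA mU.
have := @caratheodory_measure_sigma_additive R X om A; apply => //.
- by move=> i; exact: borel_caratheodory (mA i).
- exact: borel_caratheodory mU.
Qed.

Definition riesz_measure : {measure set (borel X) -> \bar R} :=
  HB.pack (outer_content : set (borel X) -> \bar R)
    (isMeasure.Build _ (borel X) R (outer_content : set (borel X) -> \bar R)
      outer_content0 outer_content_ge0 outer_content_sigma_additive).

Lemma riesz_measure_fin A : riesz_measure A \is a fin_num.
Proof. exact: outer_content_fin. Qed.

(** The measure is outer regular by construction; as it is finite and closed sets
are compact, outer regularity of the complement is inner regularity. *)
Lemma riesz_measure_radon : radon riesz_measure.
Proof.
split=> [K _|A mA]; first by rewrite ltey_eq riesz_measure_fin.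
apply/eqP; rewrite eq_le; apply/andP; split; last first.
  apply: ge_ereal_sup => _ [K [_ KA] <-]; exact: le_outer_content.
apply/lee_addgt0Pr => e e0.
have [U [oU AU Ue]] := outer_content_approx (~` A) e0.
have cU : closed (~` U) by exact: open_closedC.
have UA : ~` U `<=` A by move=> x nUx; apply: contrapT => nAx; apply: nUx; exact: AU.
apply: (@le_trans _ _ (riesz_measure (~` U) + e%:E)); last first.
  rewrite leeD2r//; apply: ereal_sup_ubound; exists (~` U) => //; split=> //.
  exact: subclosed_compact cptX _.
rewrite -(leeD2rE _ _ (riesz_measure_fin (~` A))).
apply: (@le_trans _ _ (riesz_measure (~` U) + riesz_measure U)).
  apply: (@le_trans _ _ (riesz_measure setT)).
    have /(_ setT) := borel_caratheodory mA.
    by rewrite !setTI => h; rewrite le_eqVlt; apply/orP; left; apply/eqP; exact: esym h.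
  by rewrite -[setT](setvU U); exact: (outer_measureU2 om).
rewrite -addeA leeD2l// addeC; apply: le_trans Ue.
by rewrite -outer_content_open.
Qed.

Lemma content_le_outer F : closed F -> (content F)%:E <= outer_content F.
Proof.
move=> cF; apply: le_ereal_inf_tmp => _ [V [oV FV] <-].
exact: content_le_open.
Qed.

Local Close Scope ereal_scope.

Lemma continuous_riesz_integrable f : continuous f ->
  riesz_measure.-integrable setT (EFin \o f).
Proof. by apply: continuous_integrable => //; rewrite ltey_eq riesz_measure_fin. Qed.

Local Notation int f := (\int[riesz_measure]_(x in setT) f x).
Local Notation mass A := (fine (riesz_measure A)).

Lemma functional_le_mass f F : closed F -> continuous f ->
  (forall x, f x <= (x \in F)%:R) -> Lam f <= mass F.
Proof.
move=> cF cf fF; apply: (@le_trans _ _ (content F)).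
  apply: content_ge => g [cg g0 g1]; apply: le_functional => // x.
  rewrite (le_trans (fF x))//; case: (boolP (x \in F)) => [/set_mem/g1|_]//=.
rewrite -lee_fin fineK ?riesz_measure_fin//; exact: content_le_outer.
Qed.

Lemma mass_le_int f F c : closed F -> continuous f ->
  (forall x, c * (x \in F)%:R <= f x) -> c * mass F <= int f.
Proof.
move=> cF cf fF; have mF := closed_measurable_borel cF.
have iF : riesz_measure.-integrable setT (EFin \o (\1_F : borel X -> R)).
  apply: measurable_bounded_integrable => //.
  - by rewrite ltey_eq riesz_measure_fin.
  - by exists 1; split; rewrite ?num_real// => x x1 y _ /=;
      rewrite ger0_norm// (le_trans _ (ltW x1))// indicE lern1 leq_b1.
have -> : c * mass F = int (fun x => c * \1_F x).
  by rewrite RintegralZl//; rewrite /Rintegral integral_indic// setIT.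
apply: le_Rintegral => //.
- have := integrableZl measurableT c iF; apply: eq_integrable => // x _ /=.
- exact: continuous_riesz_integrable.
- by move=> x _; rewrite indicE.
Qed.

(** [f] is cut into slices of height [c] by the truncations [min f (c * k)]. The
slice between levels [k] and [k + 1] is at most [c] on [level k] and zero
elsewhere, which bounds its value under [Lam] from above; it is equal to [c] on
[level (k + 1)], which bounds its integral from below. The shift by one level
costs [c * mass setT], and [c] is arbitrary. *)
Section slicing.
Variables (f : X -> R) (c : R).
Hypotheses (cf : continuous f) (f0 : forall x, 0 <= f x) (c0 : 0 < c).

Let trunc k x := Num.min (f x) (c * k%:R).
Let level k := [set x | c * k%:R <= f x].

Let trunc_cont k : continuous (trunc k).
Proof.
move=> x; apply: (@continuous_min R X f (cst (c * k%:R)) x); first exact: cf.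
exact: cvg_cst.
Qed.

Let slice_cont k : continuous (fun x => trunc k.+1 x - trunc k x).
Proof. by move=> x; apply: cvgB; exact: trunc_cont. Qed.

Let level_closed k : closed (level k).
Proof.
have /continuous_closedP cfP := cf.
exact: (cfP _ (@closed_ge R (c * k%:R))).
Qed.

Let intB g h : continuous g -> continuous h ->
  int (fun x => g x - h x) = int g - int h.
Proof. by move=> cg ch; rewrite RintegralB//; exact: continuous_riesz_integrable. Qed.

Lemma slicing k :
  Lam (trunc k) + c * mass (level k) <= c * mass setT + int (trunc k).
Proof.
have ck m : 0 <= c * m%:R by rewrite mulr_ge0// ltW.
elim: k => [|k ih].
  have -> : trunc 0 = fun=> 0.
    by apply/funext => x; rewrite /trunc mulr0 min_r.
  rewrite functional0 Rintegral_cst// mul0r addr0 add0r.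
  suff -> : level 0 = setT by [].
  by apply/seteqP; split=> x //= _; rewrite /level/= mulr0.
have cE : c * k.+1%:R = c * k%:R + c by rewrite -natr1 mulrDr mulr1.
have up : Lam (trunc k.+1) - Lam (trunc k) <= c * mass (level k).
  rewrite -functionalB// -ler_pdivrMl// -functionalZ//; apply: functional_le_mass => //.
    by move=> x; apply: cvgM; [exact: cvg_cst|exact: slice_cont].
  move=> x; rewrite ler_pdivrMl//; case: (boolP (x \in _)) => [_|].
    rewrite /= mulr1 /trunc cE; rewrite lerBlDr.
    rewrite ge_min; case: (leP (f x) (c * k%:R)) => h.
      by rewrite lerDr ltW.
    by rewrite addrC lexx orbT.
  rewrite notin_setE /level /= => /negP; rewrite -ltNge => h.
  rewrite /trunc (min_l (ltW h)) min_l ?subrr ?mulr0// cE.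
  by rewrite (le_trans (ltW h))// lerDl ltW.
have dn : c * mass (level k.+1) <= int (trunc k.+1) - int (trunc k).
  rewrite -intB//; apply: mass_le_int => // x.
  case: (boolP (x \in _)) => [/set_mem|_].
    rewrite /level /= => h; rewrite mulr1 /trunc (min_r h) min_r.
      by rewrite cE addrAC subrr add0r.
    by rewrite (le_trans _ h)// cE lerDl ltW.
  rewrite mulr0 subr_ge0 /trunc le_min ge_min lexx/= ge_min.
  by rewrite cE lerDl (ltW c0) orbT.
lra.
Qed.

Lemma functional_le_int_approx : Lam f <= c * mass setT + int f.
Proof.
have [M M0 fM] := continuous_compact_bounded cptX cf.
have [k kM] : exists k : nat, M <= c * k%:R.
  exists (Num.truncn (M / c)).+1; rewrite -ler_pdivrMl// mulrC ltW//.
  exact: truncnS_gt.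
have fk : trunc k = f.
  apply/funext => x; rewrite /trunc min_l// (le_trans _ kM)// (le_trans _ (fM x))//.
  exact: ler_norm.
have := slicing k; rewrite fk; apply: le_trans.
by rewrite lerDl mulr_ge0// ?fine_ge0// ltW.
Qed.

End slicing.

Lemma functional_le_int_ge0 f : continuous f -> (forall x, 0 <= f x) -> Lam f <= int f.
Proof.
move=> cf f0; apply/ler_addgt0Pr => e e0.
have m0 : 0 <= mass setT by exact: fine_ge0.
have d0 : 0 < e / (mass setT + 1) by rewrite divr_gt0// ltr_wpDl.
apply: le_trans (functional_le_int_approx cf f0 d0) _.
rewrite addrC lerD2l mulrAC ler_pdivrMr ?ltr_wpDl// ler_pM2l// lerDl.
exact: ler01.
Qed.

Lemma mass_setT : mass setT = Lam (fun=> 1).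
Proof.
apply/eqP; rewrite eq_le -!lee_fin fineK ?riesz_measure_fin//; apply/andP; split.
  rewrite [leLHS](outer_content_open openT); exact: open_content_le.
by rewrite -contentT; apply: content_le_outer; exact: closedT.
Qed.

(** A constant is added to [f] to make it nonnegative; it contributes equally to
both sides because [Lam 1] is the total mass. *)
Lemma functional_le_int f : continuous f -> Lam f <= int f.
Proof.
move=> cf; have [M M0 fM] := continuous_compact_bounded cptX cf.
have cfM : continuous (fun x => f x + M).
  by move=> x; apply: cvgD; [exact: cf|exact: cvg_cst].
have : Lam (fun x => f x + M) <= int (fun x => f x + M).
  apply: functional_le_int_ge0 => // x; rewrite -lerBlDr sub0r.
  by have := fM x; rewrite ler_norml => /andP[].
rewrite functionalD// RintegralD//; [|exact: continuous_riesz_integrable..].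
rewrite Rintegral_cst// mass_setT.
have -> : Lam (fun=> M) = M * Lam (fun=> 1).
  by rewrite -functionalZ//; congr Lam; apply/funext => x; rewrite mulr1.
by rewrite lerD2r.
Qed.

(** The reverse inequality is [functional_le_int] for [- f]. *)
Lemma riesz_measureE f : continuous f -> Lam f = int f.
Proof.
move=> cf; apply/eqP; rewrite eq_le functional_le_int//=.
have cNf : continuous (fun x => -1 * f x).
  by move=> x; apply: cvgM; [exact: cvg_cst|exact: cf].
have := functional_le_int cNf; rewrite functionalZ// RintegralZl//; first by lra.
exact: continuous_riesz_integrable.
Qed.

End riesz_markov.

Theorem riesz_markov (R : realType) (X : ptopologicalType) (Lam : (X -> R) -> R) :
  compact [set: X] -> hausdorff_space X ->
  (forall a (f g : X -> R), continuous f -> continuous g ->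
    Lam (fun x => a * f x + g x) = a * Lam f + Lam g) ->
  (forall f : X -> R, continuous f -> (forall x, 0 <= f x) -> 0 <= Lam f) ->
  exists mu : {measure set (borel X) -> \bar R}, radon mu /\
    forall f : X -> R, continuous f -> Lam f = \int[mu]_(x in [set: X]) f x.
Proof.
move=> cptX hausX Lam_lin Lam_ge0.
exists (riesz_measure cptX hausX Lam_lin Lam_ge0); split.
  exact: riesz_measure_radon.
by move=> f; exact: riesz_measureE.
Qed.

(** * Compact and Hausdorff spaces; the circle *)

Lemma separating_hausdorff (T Z : topologicalType) : hausdorff_space Z ->
  (forall x y : T, x <> y -> exists2 f : T -> Z, continuous f & f x <> f y) ->
  hausdorff_space T.
Proof.
move=> hZ sep p q pq; apply: contrapT => /sep[f cf]; apply.
apply: hZ => A B fpA fqB.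
have [z [Az Bz]] := pq _ _ (cf _ _ fpA) (cf _ _ fqB).
by exists (f z).
Qed.

Lemma setX_hausdorff (T U : topologicalType) : hausdorff_space T -> hausdorff_space U ->
  hausdorff_space (T * U)%type.
Proof.
move=> hT hU [x1 y1] [x2 y2] cl; congr pair.
- apply: hT => A B Ax Bx; have [] := cl (fst @^-1` A) (fst @^-1` B).
  + exact: (@cvg_fst _ _ (nbhs x1) (nbhs y1)).
  + exact: (@cvg_fst _ _ (nbhs x2) (nbhs y2)).
  + by move=> [a b] [/= Aa Ba]; exists a.
- apply: hU => A B Ax Bx; have [] := cl (snd @^-1` A) (snd @^-1` B).
  + exact: (@cvg_snd _ _ (nbhs x1) (nbhs y1)).
  + exact: (@cvg_snd _ _ (nbhs x2) (nbhs y2)).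
  + by move=> [a b] [/= Aa Ba]; exists b.
Qed.

Lemma set_type_compact (T : topologicalType) (A : set T) :
  compact A -> compact [set: set_type A].
Proof.
move=> cA F FF _; have [|p [Ap clp]] := cA (set_val @ F) _.
  by apply: (@filterE _ F) => x; exact: set_valP.
exists (SigSub (mem_set Ap)); split=> // B C FB.
rewrite nbhsE => -[D [[E oE <-] Ep] EC].
have [||_ [[b Bb <-] Eb]] := clp (set_val @` B) E.
- by apply: (@filterS _ F _ B) => // x Bx; exists x.
- exact: open_nbhs_nbhs.
- by exists b; split=> //; exact: EC.
Qed.

Section circle_hausdorff.
Context {R : realType}.
Implicit Types x : R.

Lemma sin_pi_int x : x \is a Num.int -> sin (pi * x) = 0.
Proof.
have sin_nat (n : nat) : sin (pi * n%:R) = 0 :> R.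
  elim: n => [|n ih]; first by rewrite mulr0 sin0.
  by rewrite -natr1 mulrDr mulr1 sinDpi ih oppr0.
move=> /intrP[[n|n] ->]; first by rewrite -pmulrn sin_nat.
by rewrite NegzE mulrNz mulrN sinN -pmulrn sin_nat oppr0.
Qed.

Lemma sin_pi_int_eq0 x : sin (pi * x) = 0 -> x \is a Num.int.
Proof.
move=> sx; pose k : R := (Num.floor x)%:~R.
have kint : k \is a Num.int by exact: intr_int.
have skx : sin (pi * (x - k)) = 0.
  by rewrite mulrBr sinB sx sin_pi_int// mul0r mulr0 subrr.
have k1 : x - k < 1 by rewrite ltrBlDl -intrD1 floorD1_gt.
have : 0 <= x - k by rewrite subr_ge0 floor_le.
rewrite le_eqVlt => /predU1P[/esym/eqP|k0]; first by rewrite subr_eq0 => /eqP ->.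
suff : 0 < sin (pi * (x - k)) by rewrite skx ltxx.
by apply: sin_gt0_pi; rewrite mulr_gt0 ?pi_gt0//= gtr_pMr// pi_gt0.
Qed.

(** The square of [sin (pi * x)] has period 1 and vanishes exactly on the integers,
so it descends to the circle and separates a given point from all others. *)
Lemma sqr_sin_pi_periodic x y : x - y \is a Num.int ->
  sin (pi * x) ^+ 2 = sin (pi * y) ^+ 2.
Proof.
move=> /sin_pi_int h.
have -> : pi * x = pi * y + pi * (x - y) by rewrite -mulrDr subrKC.
by rewrite sinD h mulr0 addr0 exprMn cos2sin2 h expr0n subr0 mulr1.
Qed.

Lemma circle_hausdorff (l : R) : hausdorff_space (circle l).
Proof.
apply: (separating_hausdorff (@Rhausdorff R)) => a b ab.
pose g (s : R) : R := sin (pi * ((s - repr b) / l)) ^+ 2.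
have cg : continuous g.
  move=> s; apply: (@continuous_comp _ _ _
    (fun s => sin (pi * ((s - repr b) / l))) (fun y => y ^+ 2)).
    apply: continuous_comp; last exact: continuous_sin.
    apply: cvgM; first exact: cvg_cst.
    by apply: cvgM; [apply: cvgB; [exact: cvg_id|exact: cvg_cst]|exact: cvg_cst].
  exact: exprn_continuous.
exists (g \o (repr : circle l -> R)).
  apply: repr_comp_continuous => // s t /eqP/eqmodP st; apply/eqP.
  by apply: sqr_sin_pi_periodic; rewrite -mulrBl opprB addrA subrK.
rewrite /= /g subrr mul0r mulr0 sin0 expr0n => /eqP; rewrite expf_eq0/= => /eqP.
move=> /sin_pi_int_eq0 h; apply: ab; rewrite -[a]reprK -[b]reprK.
exact/eqmodP.
Qed.

End circle_hausdorff.

(** * The Euclidean norm on R^3 *)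

Section euclidean_lemmas.
Context {R : realType}.
Implicit Types u v w : 'rV[R]_3.

Lemma dotC u v : dot u v = dot v u.
Proof. by apply: eq_bigr => i _; rewrite mulrC. Qed.

Lemma dotDl u v w : dot (u + v) w = dot u w + dot v w.
Proof. by rewrite /dot -big_split; apply: eq_bigr => i _; rewrite !mxE mulrDl. Qed.

Lemma dotZl a u v : dot (a *: u) v = a * dot u v.
Proof. by rewrite /dot mulr_sumr; apply: eq_bigr => i _; rewrite !mxE mulrA. Qed.

Lemma dotDr u v w : dot w (u + v) = dot w u + dot w v.
Proof. by rewrite dotC dotDl !(dotC w). Qed.

Lemma dotZr a u v : dot v (a *: u) = a * dot v u.
Proof. by rewrite dotC dotZl dotC. Qed.

Lemma dot_ge0 u : 0 <= dot u u.
Proof. by apply: sumr_ge0 => i _; rewrite -expr2 sqr_ge0. Qed.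

Lemma enorm_ge0 u : 0 <= enorm u. Proof. exact: sqrtr_ge0. Qed.

Lemma sqr_enorm u : enorm u ^+ 2 = dot u u.
Proof. by rewrite sqr_sqrtr// dot_ge0. Qed.

Lemma enormN u : enorm (- u) = enorm u.
Proof. by rewrite /enorm -scaleN1r dotZl dotZr !mulN1r opprK. Qed.

Lemma enorm_gt0 u : u != 0 -> 0 < enorm u.
Proof.
move=> u0; rewrite sqrtr_gt0 lt_neqAle dot_ge0 andbT eq_sym.
apply: contra u0; rewrite psumr_eq0; last by move=> i _; rewrite -expr2 sqr_ge0.
move=> /allP h; apply/eqP/rowP => i; rewrite mxE; apply/eqP.
by have := h i (mem_index_enum _); rewrite /= mulf_eq0 orbb.
Qed.

Lemma dot_le_enorm u v : dot u v <= enorm u * enorm v.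
Proof.
rewrite (le_trans (ler_norm _))// -ler_sqr ?nnegrE ?mulr_ge0 ?enorm_ge0//.
rewrite real_normK ?num_real// exprMn !sqr_enorm /dot !big_ord_recl !big_ord0.
set a := u _ _; set b := u _ _; set c := u _ _.
set a' := v _ _; set b' := v _ _; set c' := v _ _.
rewrite -subr_ge0.
have -> : (a * a + (b * b + (c * c + 0))) * (a' * a' + (b' * b' + (c' * c' + 0))) -
    (a * a' + (b * b' + (c * c' + 0))) ^+ 2 =
    (a * b' - b * a') ^+ 2 + (a * c' - c * a') ^+ 2 + (b * c' - c * b') ^+ 2 by ring.
by rewrite !addr_ge0// sqr_ge0.
Qed.

(** Cauchy-Schwarz against [u]: the norm lies above its tangent line at [u]. *)
Lemma enorm_segment_ge u v t : u != 0 ->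
  enorm u + t * (dot v u / enorm u) <= enorm (u + t *: v).
Proof.
move=> /enorm_gt0 u0; rewrite -(ler_pM2r u0); apply: le_trans (dot_le_enorm _ _).
by rewrite dotDl dotZl mulrDl -expr2 sqr_enorm -mulrA divfK// gt_eqF.
Qed.

(** With [d = enorm u] and [e = 2 * t * dot v u + t ^ 2 * dot v v], the squared
left-hand side is [d ^ 2 + e], which is at most [(d + e / (2 * d)) ^ 2]. *)
Lemma enorm_segment_le u v t : u != 0 ->
  enorm (u + t *: v) <=
    enorm u + t * (dot v u / enorm u) + t ^+ 2 * (dot v v / (2 * enorm u)).
Proof.
move=> /enorm_gt0 u0; set d := enorm u; set a := dot v u; set b := dot v v.
have d0 : d != 0 by rewrite gt_eqF.
have dd : dot u u = d ^+ 2 by rewrite sqr_enorm.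
have uvE : dot (u + t *: v) (u + t *: v) = d ^+ 2 + (2 * t * a + t ^+ 2 * b).
  by rewrite !(dotDl, dotDr) !(dotZl, dotZr) dd [dot u v]dotC -/a -/b; ring.
set e := 2 * t * a + t ^+ 2 * b in uvE.
have -> : d + t * (a / d) + t ^+ 2 * (b / (2 * d)) = d + e / (2 * d).
  by rewrite /e; field.
have uv0 := dot_ge0 (u + t *: v); rewrite uvE in uv0.
have h : 0 <= d + e / (2 * d).
  have -> : d + e / (2 * d) = (d ^+ 2 + (d ^+ 2 + e)) / (2 * d) by field.
  apply: divr_ge0; last by rewrite mulr_ge0// ltW.
  by rewrite addr_ge0// sqr_ge0.
rewrite -ler_sqr ?nnegrE ?enorm_ge0// sqr_enorm uvE -subr_ge0.
have -> : (d + e / (2 * d)) ^+ 2 - (d ^+ 2 + e) = (e / (2 * d)) ^+ 2 by field.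
exact: sqr_ge0.
Qed.

Lemma dot_continuous (T : topologicalType) (f g : T -> 'rV[R]_3) :
  continuous f -> continuous g -> continuous (fun x => dot (f x) (g x)).
Proof.
move=> cf cg; apply: continuous_big => [|i _ x]; first exact: add_continuous.
have c (h : T -> 'rV[R]_3) : continuous h -> h y 0 i @[y --> x] --> h x 0 i.
  move=> ch; apply: (@continuous_comp _ _ _ h (fun w : 'rV[R]_3 => w 0 i)).
    exact: ch.
  exact: coord_continuous.
by apply: cvgM; exact: c.
Qed.

End euclidean_lemmas.

(** * Struts and the first variation of the link-thickness *)

Section thickness.
Context {R : realType} (L : rectifiable_link R).
Local Notation M := (circles (len L)).
Implicit Types (f xi : M -> 'rV[R]_3) (p : M * M).

Lemma circles_hausdorff : hausdorff_space M.
Proof. by apply: sigT_hausdorff => i; exact: circle_hausdorff. Qed.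

(** Each unordered pair of points on different components, ordered as in [struts]. *)
Definition pairs : set (M * M) := [set p | (component p.1 < component p.2)%N].

Lemma pairs_compact : compact pairs.
Proof.
pose C i : set M := existT _ i @` [set: circle (len L i)].
have cptC i : compact (C i).
  apply: continuous_compact; last exact: circle_compact (len_gt0 i).
  apply: continuous_subspaceT.
  exact: (@existT_continuous _ (fun i => circle (len L i) : topologicalType)).
have -> : pairs = \big[setU/set0]_(ij : 'I_(ncomp L) * 'I_(ncomp L) |
                    (ij.1 < ij.2)%N) (C ij.1 `*` C ij.2).
  rewrite -(bigcup_pred
    [pred ij : 'I_(ncomp L) * 'I_(ncomp L) | (ij.1 < ij.2)%N]); apply/seteqP.
  split=> [[[i x] [j y]]|[x y]] /=.
    by exists (i, j); [|split; [exists x|exists y]].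
  by move=> [[i j] ij /= [[? _ <-] [? _ <-]]].
by apply: bigsetU_compact => ij _; exact: compact_setX.
Qed.

Definition chord f p : 'rV[R]_3 := f p.2 - f p.1.

Lemma chord_continuous f : continuous f -> continuous (chord f).
Proof.
move=> cf p; apply: cvgB; apply: continuous_comp (cf _).
  exact: cvg_snd.
exact: cvg_fst.
Qed.

Lemma chord_neq0 p : pairs p -> chord L p != 0.
Proof.
move=> pp; rewrite subr_eq0 eq_sym; apply: curve_disjoint.
by apply/eqP => e; move: pp; rewrite /pairs /= e ltnn.
Qed.

Lemma LThi_le f p : pairs p -> LThi f <= enorm (chord f p).
Proof.
move=> pp; apply: inf_lbound; first by exists 0 => _ [x [y [_ ->]]]; exact: enorm_ge0.
exists p.1, p.2; split=> //.
by apply/eqP => e; move: pp; rewrite /pairs /= e ltnn.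
Qed.

Lemma LThi_ge f a : (forall p, pairs p -> a <= enorm (chord f p)) -> a <= LThi f.
Proof.
move=> h; apply: lb_le_inf.
  pose i0 := Ordinal (ltnW (ncomp_gt1 L)); pose i1 := Ordinal (ncomp_gt1 L).
  by exists (enorm (f (pt (len L) i1 0) - f (pt (len L) i0 0))),
    (pt (len L) i0 0), (pt (len L) i1 0).
move=> _ [x [y [xy ->]]].
have [lt12|lt21|e12] := ltngtP (component x) (component y).
- exact: (h (x, y)).
- by rewrite -enormN opprB; exact: (h (y, x)).
- by move: xy; rewrite (val_inj e12) eqxx.
Qed.

Lemma enorm_chord_continuous : continuous (fun p => enorm (chord L p)).
Proof.
move=> p; apply: continuous_comp; last exact: enorm_continuous.
exact/chord_continuous/curve_continuous.
Qed.

Lemma struts_compact : compact (@struts R L).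
Proof.
have -> : @struts R L = pairs `&` [set p | enorm (chord L p) = LThi L] by [].
apply: compact_closedI; first exact: pairs_compact.
have /continuous_closedP c := enorm_chord_continuous.
by have := c _ (@closed_eq R (LThi L)).
Qed.

Lemma Strut_compact : compact [set: Strut L].
Proof. exact/set_type_compact/struts_compact. Qed.

Lemma Strut_val_continuous : continuous (fun p : Strut L => val p : M * M).
Proof. exact: initial_continuous. Qed.

Lemma Strut_hausdorff : hausdorff_space (Strut L).
Proof.
apply: (separating_hausdorff (setX_hausdorff circles_hausdorff circles_hausdorff)).
move=> x y xy; exists (fun p : Strut L => val p : M * M).
  exact: Strut_val_continuous.
by move=> /val_inj.
Qed.

Lemma strut_pair (p : Strut L) : pairs (val p).
Proof. by have [] := set_mem (valP p). Qed.

Lemma strut_enorm (p : Strut L) : enorm (chord L (val p)) = LThi L.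
Proof. by have [] := set_mem (valP p). Qed.

(** The derivative of [enorm (chord L p)] under [xi]: the rigidity operator,
extended from the struts to all pairs. *)
Definition stretch xi p := dot (chord xi p) (chord L p) / enorm (chord L p).

Lemma stretch_continuous xi p : continuous xi -> pairs p ->
  {for p, continuous (stretch xi)}.
Proof.
move=> cxi pp; apply: cvgM.
  by apply: dot_continuous; apply: chord_continuous => //; exact: curve_continuous.
apply: cvgV; first by rewrite gt_eqF// enorm_gt0// chord_neq0.
exact: enorm_chord_continuous.
Qed.

Lemma rigidityE xi (p : Strut L) : rigidity xi p = stretch xi (val p).
Proof. by []. Qed.

Lemma rigidity_continuous xi : continuous xi -> continuous (rigidity xi : Strut L -> R).
Proof.
move=> cxi p.
apply: (@continuous_comp _ _ _ (fun p : Strut L => val p : M * M) (stretch xi)).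
  exact: Strut_val_continuous.
exact/stretch_continuous/strut_pair.
Qed.

Lemma chord_variation xi t p :
  chord (fun x => L x + t *: xi x) p = chord L p + t *: chord xi p.
Proof. by rewrite /chord scalerBr opprD addrACA. Qed.

Lemma LThi_variation_le xi t (p : Strut L) :
  LThi (fun x => L x + t *: xi x) <= LThi L + t * rigidity xi p +
    t ^+ 2 * (dot (chord xi (val p)) (chord xi (val p)) / (2 * LThi L)).
Proof.
apply: le_trans (LThi_le _ (strut_pair p)) _.
rewrite chord_variation -(strut_enorm p); apply: enorm_segment_le.
exact/chord_neq0/strut_pair.
Qed.

(** Chords lie above their tangent lines, so [LThi L + t * stretch xi p] is a lower
bound. Near a pair where the stretch exceeds [a] this suffices. Any other pair
is not a strut, so its chord is longer than [LThi L] by a margin that absorbs the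
deficit for small [t]. Compactness of [pairs] makes the choice of [t] uniform. *)
Lemma LThi_variation_ge xi a : continuous xi ->
  (forall p : Strut L, a < rigidity xi p) ->
  \forall t \near 0^'+, LThi L + t * a <= LThi (fun x => L x + t *: xi x).
Proof.
move=> cxi ha.
suff h : \forall t \near 0^'+, pairs `<=`
    (fun p => pairs p -> LThi L + t * a <= enorm (chord L p + t *: chord xi p)).
  by apply: filterS h => t h; apply: LThi_ge => p pp; rewrite chord_variation; exact: h.
have /compact_near_coveringP cov := pairs_compact.
apply: cov => p pp.
have segm t q : pairs q ->
    enorm (chord L q) + t * stretch xi q <= enorm (chord L q + t *: chord xi q).
  by move=> pq; exact/enorm_segment_ge/chord_neq0.
have cs := stretch_continuous cxi pp.
have [ag|ga] := ltP a (stretch xi p).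
  exists ([set q | a < stretch xi q], [set t | 0 < t]) => /=.
    split; last exact: nbhs_right_gt.
    exact: (cvgr_gt (stretch xi p) cs).
  move=> [q t] [/= aq t0] pq; apply: le_trans (segm t q pq).
  by rewrite lerD ?LThi_le// ler_wpM2l ?ltW.
have dp : LThi L < enorm (chord L p).
  rewrite lt_neqAle LThi_le// andbT; apply/eqP => e.
  have sp : p \in @struts R L by apply/mem_set; split.
  by have := ha (SigSub sp); rewrite ltNge rigidityE /= ga.
pose d := (enorm (chord L p) - LThi L) / 2.
have d0 : 0 < d by rewrite divr_gt0// subr_gt0.
pose c := a - stretch xi p + 1.
have c0 : 0 < c by rewrite ltr_wpDl// subr_ge0.
exists ([set q | LThi L + d < enorm (chord L q) /\ stretch xi p - 1 < stretch xi q],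
        [set t | 0 < t /\ t < d / c]) => /=.
  split.
    near=> q; split; near: q.
      apply: (cvgr_gt (enorm (chord L p)) (@enorm_chord_continuous p)).
      rewrite /d; lra.
    by apply: (cvgr_gt (stretch xi p) cs); rewrite ltrBlDr ltrDl.
  near=> t; split; near: t; first exact: nbhs_right_gt.
  by apply: nbhs_right_lt; rewrite divr_gt0.
move=> [q t] [/= [dq sq] [t0 tdc]] pq; apply: le_trans (segm t q pq).
have : t * c < d by rewrite -ltr_pdivlMr.
have : t * (stretch xi p - 1) <= t * stretch xi q by rewrite ler_wpM2l ?ltW.
rewrite /c => h1 h2.
have e : t * (a - stretch xi p + 1) = t * a - t * (stretch xi p - 1) by ring.
rewrite e in h2; lra.
Unshelve. all: by end_near. Qed.

Lemma rigidity_min xi : continuous xi ->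
  exists p : Strut L, forall q : Strut L, rigidity xi p <= rigidity xi q.
Proof.
move=> cxi; have [|||p _ h] := @compact_EVT_min _ _ (rigidity xi : Strut L -> R) setT.
- by exists (strut_point L).
- exact: Strut_compact.
- exact/continuous_subspaceT/rigidity_continuous.
- by exists p => q; apply: h; exact: mem_set.
Qed.

(** Danskin's theorem for the minimum defining the link-thickness: the chord of the
strut [p] bounds the difference quotient from above up to an error linear in
[t], and [LThi_variation_ge] bounds it from below. *)
Lemma dLThi_min xi (p : Strut L) : continuous xi ->
  (forall q, rigidity xi p <= rigidity xi q) -> dLThi xi = rigidity xi p.
Proof.
move=> cxi pmin; apply: cvg_lim; first exact: Rhausdorff.
set m := rigidity xi p.
pose C := dot (chord xi (val p)) (chord xi (val p)) / (2 * LThi L).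
have C0 : 0 <= C.
  by rewrite divr_ge0 ?dot_ge0// mulr_ge0// -(strut_enorm p) enorm_ge0.
apply/cvgrPdist_le => e e0.
have hge : forall q : Strut L, m - e < rigidity xi q.
  by move=> q; rewrite ltrBlDr (le_lt_trans (pmin q))// ltrDl.
near=> t.
have t0 : 0 < t by near: t; exact: nbhs_right_gt.
have te : t * (C + 1) < e.
  rewrite -ltr_pdivlMr ?ltr_wpDl//; near: t; apply: nbhs_right_lt.
  by rewrite divr_gt0// ltr_wpDl.
have le1 : LThi L + t * (m - e) <= LThi (fun x => L x + t *: xi x).
  by near: t; exact: LThi_variation_ge.
have le2 := LThi_variation_le xi t p; rewrite -/m -/C in le2.
set q := (_ / t).
have q1 : q <= m + e by rewrite ler_pdivrMr//; nra.
have q2 : m - e <= q by rewrite ler_pdivlMr//; lra.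
by rewrite ler_norml; apply/andP; split; lra.
Unshelve. all: by end_near. Qed.

End thickness.

(** * First variation of length *)

Section derivative_measurable.
Context {R : realType}.
Variables (f : R -> R).
Hypothesis cf : continuous f.

Definition slope (h s : R) : R := h^-1 * (f (h + s) - f s).

Definition derivability_set : set R := [set s | derivable f s 1].

Lemma slope_continuous h : continuous (slope h).
Proof.
move=> s; apply: cvgM; first exact: cvg_cst.
apply: cvgB; last exact: cf.
apply: continuous_comp; last exact: cf.
by apply: cvgD; [exact: cvg_cst|exact: cvg_id].
Qed.

Lemma derivable_slopeP s : derivable f s 1 <-> cvg (slope h s @[h --> 0^']).
Proof.
rewrite /derivable; set q := (fun h => _).
suff -> : q = slope^~ s by [].
by apply/funext => h; rewrite /q /slope /= [h%:A]mulr1.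
Qed.

Lemma near_dnbhs0P (P : R -> Prop) : (\forall h \near 0^', P h) <->
  exists m : nat, forall h, 0 < `|h| < m.+1%:R^-1 -> P h.
Proof.
split=> [|[m hm]].
  rewrite /dnbhs /within /= => /nbhs_ballP[d /= d0 dP].
  near \oo => m; exists m => h /andP[h0 hm]; apply: dP; last by rewrite -normr_gt0.
  rewrite -ball_normE /= sub0r normrN (lt_trans hm)//.
  near: m; exact: (near_infty_natSinv_lt (PosNum d0)).
have m0 : (0 : R) < m.+1%:R^-1 by rewrite invr_gt0 ltr0n.
near=> h; apply: hm; apply/andP; split.
  by rewrite normr_gt0; near: h; exact: nbhs_dnbhs_neq.
by near: h; exact: dnbhs0_lt.
Unshelve. all: by end_near. Qed.

(** Points where difference quotients with steps below [1 / (m + 1)] differ by at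
most [1 / (k + 1)]. As an intersection of closed sets indexed by all pairs of
steps it is closed, so Borel without restricting to rational steps. *)
Let osc (k m : nat) : set R := \bigcap_(hh in [set hh : R * R |
  0 < `|hh.1| < m.+1%:R^-1 /\ 0 < `|hh.2| < m.+1%:R^-1])
  [set s | `|slope hh.1 s - slope hh.2 s| <= k.+1%:R^-1].

(** Cauchy's criterion for the convergence of the difference quotients. *)
Lemma derivability_setE : derivability_set = \bigcap_k \bigcup_m osc k m.
Proof.
apply/seteqP; split=> s /=.
  move=> /derivable_slopeP/cvg_ex[l /cvgrPdist_le hl] k _.
  have e0 : (0 : R) < k.+1%:R^-1 / 2 by rewrite divr_gt0// invr_gt0 ltr0n.
  have /near_dnbhs0P[m hm] := hl _ e0.
  exists m => // -[h h'] /= [h1 h2].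
  have -> : slope h s - slope h' s = (l - slope h' s) - (l - slope h s) by ring.
  rewrite (le_trans (ler_normB _ _))// [leRHS]splitr.
  by apply: lerD; exact: hm.
move=> hs; apply/derivable_slopeP; apply/cauchy_cvgP; apply: cauchy_exP => e e0.
near \oo => k.
have ke : k.+1%:R^-1 < e by near: k; exact: (near_infty_natSinv_lt (PosNum e0)).
have [m _ hm] := hs k I.
(* A reference step: all slopes with small steps are within [e] of its slope. *)
pose h0 : R := m.+2%:R^-1.
have h0m : 0 < `|h0| < m.+1%:R^-1.
  by rewrite gtr0_norm ?invr_gt0 ?ltr0n//= ltf_pV2 ?posrE ?ltr0n// ltr_nat.
exists (slope h0 s); apply/near_dnbhs0P; exists m => h hP.
rewrite -ball_normE /=; apply: le_lt_trans ke.
exact: (hm (h0, h)).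
Unshelve. all: by end_near. Qed.

Lemma derivability_set_measurable : measurable derivability_set.
Proof.
rewrite derivability_setE; apply: bigcapT_measurable => k.
apply: bigcupT_measurable => m; apply: closed_measurable.
apply: closed_bigI => -[h h'] _ /=.
have /continuous_closedP c : continuous (fun s => `|slope h s - slope h' s|).
  by move=> s; apply: cvg_norm; apply: cvgB; exact: slope_continuous.
exact: (c _ (@closed_le R k.+1%:R^-1)).
Qed.

Lemma derive1_measurable : measurable_fun derivability_set (derive1 f).
Proof.
apply: (@measurable_fun_cvg _ _ _ _ (fun n => slope n.+1%:R^-1)) => [n|s].
  apply: measurable_funTS; apply: continuous_measurable_fun.
  exact: slope_continuous.
move=> /derivable_slopeP cs.
have h0 : (n.+1%:R^-1 : R) @[n --> \oo] --> 0^'.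
  move=> A hA.
  have : \forall n \near \oo, harmonic n != 0 :> R -> A (harmonic n).
    exact: (cvg_harmonic hA).
  apply: filterS => n; apply.
  by rewrite gt_eqF// invr_gt0 ltr0n.
exact: (cvg_comp _ _ h0 cs).
Qed.

Lemma derive1_le s (k : R) : (forall a b, `|f b - f a| <= k * `|b - a|) ->
  derivable f s 1 -> `|derive1 f s| <= k.
Proof.
move=> fk /derivable_slopeP cs.
have bnd h : h != 0 -> `|slope h s| <= k.
  move=> h0; rewrite normrM normfV ler_pdivrMl ?normr_gt0// mulrC.
  by have := fk s (h + s); rewrite addrK.
rewrite ler_norml; apply/andP; split.
- apply: limr_ge => //; near=> h.
  have : `|slope h s| <= k by apply: bnd; near: h; exact: nbhs_dnbhs_neq.
  by rewrite ler_norml => /andP[].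
- apply: limr_le => //; near=> h.
  have : `|slope h s| <= k by apply: bnd; near: h; exact: nbhs_dnbhs_neq.
  by rewrite ler_norml => /andP[].
Unshelve. all: by end_near. Qed.

End derivative_measurable.

Section tangent.
Context {R : realType} (L : rectifiable_link R).
Local Notation M := (circles (len L)).
Implicit Types (i : 'I_(ncomp L)) (j : 'I_3) (xi eta : M -> 'rV[R]_3).

Lemma coord_le_enorm (u : 'rV[R]_3) j : `|u 0 j| <= enorm u.
Proof.
rewrite -ler_sqr ?nnegrE ?enorm_ge0// sqr_enorm real_normK ?num_real//.
rewrite /dot (bigD1 j)//= -expr2 lerDl.
by apply: sumr_ge0 => k _; rewrite -expr2 sqr_ge0.
Qed.

(** The two-point partition in the definition of arc length. *)
Lemma arclength_chord i a b : enorm (along L i b - along L i a) <= `|b - a|.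
Proof.
wlog ab : a b / a <= b.
  move=> h; have [|/ltW ba] := leP a b; first exact: h.
  by rewrite -enormN opprB distrC; exact: h.
move: (ab); rewrite le_eqVlt => /predU1P[->|ltab].
  by rewrite subrr /enorm /dot big1 ?sqrtr0// => k _; rewrite mxE mul0r.
rewrite ger0_norm ?subr_ge0// -lee_fin -(curve_arclength i ab).
apply: ereal_sup_ubound; exists [:: b]; first exact: itv_partition1.
by rewrite /polygon_length /= big_nat1.
Qed.

Let coord i j (s : R) : R := along L i s 0 j.

Lemma coord_lipschitz i j a b : `|coord i j b - coord i j a| <= 1 * `|b - a|.
Proof.
rewrite mul1r (le_trans _ (arclength_chord i a b))//.
by rewrite (le_trans _ (coord_le_enorm _ j))// !mxE.
Qed.

Lemma coord_continuous_arclength i j : continuous (coord i j).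
Proof.
move=> s; apply/cvgrPdist_le => e e0; near=> t.
rewrite (le_trans (coord_lipschitz i j t s))// mul1r.
by near: t; exact: cvgr_dist_le.
Unshelve. all: by end_near. Qed.

Let regular i : set R := \bigcap_(j in [set: 'I_3]) derivability_set (coord i j).

Lemma regularP i s : regular i s <-> derivable (along L i) s 1.
Proof.
split=> [h|/derivable_mxP h j _]; last exact: h.
by apply/derivable_mxP => k j; rewrite (ord1 k); exact: h.
Qed.

Lemma regular_measurable i : measurable (regular i).
Proof.
apply: fin_bigcap_measurable => // j _.
by apply: derivability_set_measurable; exact: coord_continuous_arclength.
Qed.

Lemma tangent_regular i j s : regular i s -> tangent i s 0 j = derive1 (coord i j) s.
Proof. by move=> /regularP h; rewrite /tangent derive1E derive_mx// mxE derive1E. Qed.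

(** Where the derivative does not exist, the limit defining the tangent takes its
default value. *)
Lemma tangent_irregular i s : ~ regular i s -> tangent i s = point.
Proof.
move=> h; apply: dvgP => c; apply: h; apply/regularP; move: c.
rewrite /derivable; set q := (fun h => _); set q' := (fun h => _).
suff -> : q = q' by [].
by apply/funext => h; rewrite /q /q' /= [h%:A]mulr1.
Qed.

Lemma tangent_measurable i j : measurable_fun [set: R] (fun s => tangent i s 0 j).
Proof.
have mR := regular_measurable i.
rewrite -(setvU (regular i)) setUC.
apply/measurable_funU => //; first exact: measurableC.
split.
  apply: (@eq_measurable_fun _ _ _ _ _ (derive1 (coord i j))).
    by move=> s /set_mem rs; rewrite tangent_regular.
  apply: (@measurable_funS _ _ _ _ (derivability_set (coord i j))).
  - by apply: derivability_set_measurable; exact: coord_continuous_arclength.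
  - by move=> s; apply.
  - by apply: derive1_measurable; exact: coord_continuous_arclength.
apply: (@eq_measurable_fun _ _ _ _ _ (fun=> (point : 'rV[R]_3) 0 j)).
  by move=> s /set_mem rs; rewrite tangent_irregular.
exact: measurable_cst.
Qed.

Lemma tangent_bounded i j :
  exists2 K, 0 <= K & forall s, `|tangent i s 0 j| <= K.
Proof.
exists (1 + `|(point : 'rV[R]_3) 0 j|); first by rewrite addr_ge0.
move=> s; have [rs|nrs] := pselect (regular i s).
  rewrite tangent_regular// (@le_trans _ _ 1)// ?lerDl//.
  by apply: derive1_le (rs j I); exact: coord_lipschitz.
by rewrite tangent_irregular// lerDr.
Qed.

Lemma derive1n_linear a xi eta i k : VF_smooth xi -> VF_smooth eta ->
  derive1n k (along (fun x => a *: xi x + eta x) i) =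
  (a \*: derive1n k (along xi i)) + derive1n k (along eta i).
Proof.
move=> [_ sxi] [_ seta]; elim: k => [//|k ih].
rewrite derive1nS ih; apply/funext => s.
rewrite derive1E deriveD; [|exact: derivableZ|exact: seta].
rewrite deriveZ; last exact: sxi.
exact: (congr2 +%R (congr1 ( *:%R a) (esym (derive1E _ _))) (esym (derive1E _ _))).
Qed.

Lemma VF_smooth_linear a xi eta : VF_smooth xi -> VF_smooth eta ->
  VF_smooth (fun x => a *: xi x + eta x).
Proof.
move=> sxi seta; split=> [x|i k s].
  apply: cvgD; last exact: seta.1.
  by apply: cvgZl_tmp; exact: sxi.1.
rewrite derive1n_linear; [|exact: sxi|exact: seta].
apply: derivableD; last exact: seta.2.
by apply: derivableZ; exact: sxi.2.
Qed.

Lemma VF_smooth0 : VF_smooth (fun _ : M => 0 : 'rV[R]_3).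
Proof.
split=> [x|i k s]; first exact: cvg_cst.
have -> : derive1n k (along (fun _ : M => 0 : 'rV[R]_3) i) = cst 0.
  elim: k => [//|k ih]; rewrite derive1nS ih; apply/funext => t.
  exact: derive1_cst.
exact: derivable_cst.
Qed.

Lemma derive1_along_continuous xi i j : VF_smooth xi ->
  continuous (fun s => derive1 (along xi i) s 0 j).
Proof.
move=> sxi s.
apply: (@continuous_comp _ _ _ (derive1 (along xi i)) (fun u : 'rV[R]_3 => u 0 j)).
  apply: differentiable_continuous; apply/derivable1_diffP.
  exact: (sxi.2 i 1%N s).
exact: coord_continuous.
Qed.

Lemma dLen_integrable xi i : VF_smooth xi ->
  (@lebesgue_measure R).-integrable `[0, len L i]
    (EFin \o (fun s => dot (tangent i s) (derive1 (along xi i) s))).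
Proof.
move=> sxi.
have -> : EFin \o (fun s => dot (tangent i s) (derive1 (along xi i) s)) =
    (fun s => \sum_(j < 3) (tangent i s 0 j * derive1 (along xi i) s 0 j)%:E)%E.
  by apply/funext => s /=; rewrite /dot sumEFin.
apply: integrable_sum => // j _.
have bt : [bounded tangent i s 0 j | s in `[0, len L i]].
  have [K K0 hK] := tangent_bounded i j.
  exists K; split; rewrite ?num_real// => x Kx s _ /=.
  exact: le_trans (hK s) (ltW Kx).
have ic : (@lebesgue_measure R).-integrable `[0, len L i]
    (EFin \o (fun s => derive1 (along xi i) s 0 j)).
  apply: continuous_compact_integrable; first exact: segment_compact.
  exact/continuous_subspaceT/derive1_along_continuous.
have h : (@lebesgue_measure R).-integrable `[0, len L i]
    ((EFin \o (fun s => tangent i s 0%R j)) \*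
     (EFin \o (fun s => derive1 (along xi i) s 0%R j)))%E.
  by apply: integrableMr => //; apply: measurable_funTS; exact: tangent_measurable.
by apply: eq_integrable h => // s _ /=; rewrite EFinM.
Qed.

Lemma dLen_linear a xi eta : VF_smooth xi -> VF_smooth eta ->
  dLen (fun x => a *: xi x + eta x) = a * dLen xi + dLen eta.
Proof.
move=> sxi seta; rewrite /dLen mulr_sumr -big_split; apply: eq_bigr => i _.
have ixi := dLen_integrable i sxi; have ieta := dLen_integrable i seta.
pose A eta' s := dot (tangent i s) (derive1 (along eta' i) s).
transitivity (\int[lebesgue_measure]_(s in `[0, len L i]) (a * A xi s + A eta s)).
  apply: eq_Rintegral => s _.
  have /(congr1 (fun g => g s)) := derive1n_linear a i 1 sxi seta.
  by rewrite /A /= => ->; rewrite dotDr dotZr.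
rewrite RintegralD//; first by rewrite RintegralZl.
have h : (@lebesgue_measure R).-integrable `[0, len L i]
    (fun s => a%:E * (EFin \o A xi) s)%E by exact: integrableZl.
by apply: eq_integrable h => // s _ /=; rewrite EFinM.
Qed.

End tangent.

(** * Duality between length and thickness *)

Section positive_sup.
Context {R : realType} {X : ptopologicalType}.
Hypothesis cptX : compact [set: X].
Implicit Types f g : X -> R.

Definition positive_sup f : R := sup (range (fun x => Num.max (f x) 0)).

Lemma positive_sup_ub f x : continuous f -> Num.max (f x) 0 <= positive_sup f.
Proof.
move=> cf; apply: ub_le_sup; last by exists x.
have [M M0 fM] := continuous_compact_bounded cptX cf.
exists M => _ [y _ <-]; rewrite ge_max (ltW M0) andbT.
exact: le_trans (ler_norm _) (fM y).
Qed.

Lemma positive_sup_le f a : (forall x, Num.max (f x) 0 <= a) -> positive_sup f <= a.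
Proof.
move=> fa; apply: ge_sup; first by exists (Num.max (f point) 0), point.
by move=> _ [y _ <-].
Qed.

Lemma positive_sup_ge0 f : continuous f -> 0 <= positive_sup f.
Proof.
by move=> cf; apply: le_trans (positive_sup_ub point cf); rewrite le_max lexx orbT.
Qed.

Lemma positive_supD f g : continuous f -> continuous g ->
  positive_sup (fun x => f x + g x) <= positive_sup f + positive_sup g.
Proof.
move=> cf cg; apply: positive_sup_le => x.
have := positive_sup_ub x cf; have := positive_sup_ub x cg.
by rewrite !ge_max => /andP[? ?] /andP[? ?]; apply/andP; split; lra.
Qed.

Lemma positive_supZ_le f a : 0 < a -> continuous f ->
  positive_sup (fun x => a * f x) <= a * positive_sup f.
Proof.
move=> a0 cf; apply: positive_sup_le => x.
have := positive_sup_ub x cf; rewrite !ge_max => /andP[fx s0].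
by rewrite ler_pM2l// fx mulr_ge0// ltW.
Qed.

Lemma positive_supZ f a : 0 < a -> continuous f ->
  positive_sup (fun x => a * f x) = a * positive_sup f.
Proof.
move=> a0 cf; apply/eqP; rewrite eq_le positive_supZ_le//= -ler_pdivlMl//.
have caf : continuous (fun x => a * f x).
  by move=> x; apply: cvgM; [exact: cvg_cst|exact: cf].
have -> : f = (fun x => a^-1 * (a * f x)).
  by apply/funext => x; rewrite mulKf// gt_eqF.
under [X in _ <= _ * positive_sup X]eq_fun do rewrite mulKf ?gt_eqF//.
by apply: positive_supZ_le => //; rewrite invr_gt0.
Qed.

End positive_sup.

Section criticality.
Context {R : realType} (L : rectifiable_link R).
Local Notation M := (circles (len L)).
Implicit Types xi eta : M -> 'rV[R]_3.

Lemma rigidity_linear a xi eta (p : Strut L) :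
  rigidity (fun x => a *: xi x + eta x) p = a * rigidity xi p + rigidity eta p.
Proof.
rewrite !rigidityE /stretch mulrA -mulrDl -dotZl -dotDl.
by congr (dot _ _ / _); rewrite /chord scalerBr opprD addrACA.
Qed.

(** When [dLen xi] is positive, the field [- (dLen xi)^-1 *: xi] has length
variation [-1], so its rigidity is at most [- e] at some strut; there the
rigidity of [xi] is at least [e * dLen xi]. *)
Lemma strongly_critical_bound e : 0 < e ->
  (forall xi, VF_smooth xi -> dLen xi = -1 -> dLThi xi <= - e) ->
  forall xi, VF_smooth xi ->
    dLen xi <= e^-1 * positive_sup (rigidity xi : Strut L -> R).
Proof.
move=> e0 crit xi sxi; have cr := rigidity_continuous sxi.1.
have [d0|d0] := leP (dLen xi) 0.
  rewrite (le_trans d0)// mulr_ge0 ?invr_ge0 ?(ltW e0)// positive_sup_ge0//.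
  exact: Strut_compact.
(* [a *: xi + xi] is the multiple of [xi] by [- (dLen xi)^-1]. *)
pose a := - (dLen xi)^-1 - 1.
have seta := VF_smooth_linear a sxi sxi.
have deta : dLen (fun x => a *: xi x + xi x) = -1.
  by rewrite dLen_linear// /a mulrBl mulNr mulVf ?gt_eqF// mul1r subrK.
have [p pmin] := rigidity_min seta.1.
have := crit _ seta deta; rewrite (dLThi_min seta.1 pmin) rigidity_linear.
have -> : a * rigidity xi p + rigidity xi p = - ((dLen xi)^-1 * rigidity xi p).
  by rewrite /a; ring.
rewrite lerN2 ler_pdivlMl// mulrC => h.
rewrite ler_pdivlMl// (le_trans h)//.
apply: le_trans (positive_sup_ub (@Strut_compact R L) p cr).
by rewrite le_max lexx.
Qed.

(** Hahn-Banach applied to the graph of the pairs [(rigidity xi, dLen xi)], followed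
by Riesz-Markov. *)
Lemma strongly_critical_measure : strongly_critical L ->
  exists mu : {measure set (borel (Strut L)) -> \bar R}, radon mu /\
    forall xi, VF_smooth xi -> dLen xi = \int[mu]_(p in [set: Strut L]) rigidity xi p.
Proof.
move=> [e e0 crit].
pose D : set (Strut L -> R^o) := [set f | continuous (f : Strut L -> R)].
pose p (f : Strut L -> R^o) := e^-1 * positive_sup (f : Strut L -> R).
pose G : set ((Strut L -> R^o) * R) := [set (rigidity xi : Strut L -> R^o, dLen xi) |
  xi in [set xi | VF_smooth xi]].
have ei0 : 0 < e^-1 by rewrite invr_gt0.
have cpt := @Strut_compact R L.
have [||||/=|Lam [Lam_lin Lam_le LamG]] := @hahn_banach R (Strut L -> R^o) D p _ _ _ G.
- by move=> a f g; exact: continuous_lin.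
- move=> f g cf cg; rewrite /p -mulrDr ler_pM2l//; exact: positive_supD.
- by move=> a f a0 cf; rewrite /p mulrCA; congr (_ * _); exact: positive_supZ.
- split=> [a _ _ [xi sxi <-] [eta seta <-] /=|_ [xi sxi <-] /=].
    exists (fun x => a *: xi x + eta x).
      exact: (VF_smooth_linear a sxi seta).
    congr pair.
      apply/funext => q.
      exact: (rigidity_linear a xi eta q).
    exact: (dLen_linear a sxi seta).
  split; first exact: (rigidity_continuous sxi.1).
  exact: strongly_critical_bound.
- exists (rigidity (fun _ : M => 0) : Strut L -> R^o, dLen (fun _ : M => 0)).
  by exists (fun _ : M => 0); [exact: VF_smooth0|].
have Lam_ge0 (f : Strut L -> R) : continuous f -> (forall x, 0 <= f x) -> 0 <= Lam f.
  move=> cf f0.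
  (* [- f] is written [-2 f + f] to use linearity in its one available form. *)
  have h : Lam ((-2) *: (f : Strut L -> R^o) + f) = - Lam f by rewrite Lam_lin//; ring.
  have : Lam ((-2) *: (f : Strut L -> R^o) + f) <= 0.
    apply: (@le_trans _ _ (p (fun x => (-2) * f x + f x))).
      by apply: Lam_le; exact: (@continuous_lin _ _ (-2) f f cf cf).
    rewrite /p pmulr_rle0//; apply: positive_sup_le => x.
    have := f0 x; rewrite ge_max lexx andbT /=.
    by move=> fx; lra.
  by rewrite h oppr_le0.
have Lam_lin' a (f g : Strut L -> R) : continuous f -> continuous g ->
  Lam (fun x => a * f x + g x) = a * Lam f + Lam g by move=> cf cg; exact: Lam_lin.
have [mu [rmu muE]] := riesz_markov cpt (@Strut_hausdorff R L) Lam_lin' Lam_ge0.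
exists mu; split=> // xi sxi; rewrite -muE; last exact: (rigidity_continuous sxi.1).
by apply/esym/(LamG (rigidity xi : Strut L -> R^o, dLen xi)); exists xi.
Qed.

(** The total mass may vanish, hence the constant [(m + 1)^-1] instead of [m^-1]. *)
Lemma measure_strongly_critical (mu : {measure set (borel (Strut L)) -> \bar R}) :
  radon mu ->
  (forall xi, VF_smooth xi -> dLen xi = \int[mu]_(p in [set: Strut L]) rigidity xi p) ->
  strongly_critical L.
Proof.
move=> [mu_fin _] muE; have cpt := @Strut_compact R L.
have muT := mu_fin _ cpt.
pose m := fine (mu setT); have m0 : 0 <= m by exact: fine_ge0.
have m1 : 0 < m + 1 by rewrite ltr_wpDl.
exists (m + 1)^-1; first by rewrite invr_gt0.
move=> xi sxi dxi; have [p pmin] := rigidity_min sxi.1.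
rewrite (dLThi_min sxi.1 pmin).
have : rigidity xi p * m <= -1.
  rewrite -dxi (muE _ sxi) -Rintegral_cst//; apply: le_Rintegral => //.
  - by apply: continuous_integrable => //; exact: cst_continuous.
  - by apply: continuous_integrable => //; exact: rigidity_continuous sxi.1.
move=> h; rewrite leNgt; apply/negP => hlt.
have : - (m + 1)^-1 * m <= rigidity xi p * m by rewrite ler_wpM2r// ltW.
have : (m + 1)^-1 * (m + 1) = 1 by rewrite mulVf// gt_eqF.
have : 0 < (m + 1)^-1 by rewrite invr_gt0.
lra.
Qed.

End criticality.

Theorem theorem6p1 (R : realType) (L : rectifiable_link R) :
  strongly_critical L <->
  exists mu : {measure set (borel (Strut L)) -> \bar R},
    radon mu /\
    forall xi : circles (len L) -> 'rV[R]_3, VF_smooth xi ->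
      dLen xi = \int[mu]_(p in [set: Strut L]) rigidity xi p.
Proof.
split; first exact: strongly_critical_measure.
by move=> [mu [rmu muE]]; exact: measure_strongly_critical rmu muE.
Qed.
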